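(* Let $k=n^2$ for some integer $n\ge2$. Then Next-Fit is a worst possible fair algorithm for Edge-$k$-Coloring(Tree), with $$C_{\mathrm{NF}}^{\text{Tree}}(k)=\frac{2\sqrt{k}-2}{2\sqrt{k}-1};$$ that is, NF has exactly this competitive ratio, and every fair online algorithm for Edge-$k$-Coloring(Tree) has competitive ratio at least this value.
   Context: Online dual edge coloring, Edge-$k$-Coloring: a number $k$ of colors $1,\dots,k$ is given. The edges of a simple graph arrive one by one, each specified by its two endpoints. Upon arrival, an edge must irrevocably either be colored with one of the $k$ colors, such that no two adjacent (sharing an endpoint) colored edges receive the same color, or be rejected. The goal is to color as many edges as possible. Edge-$k$-Coloring(Tree) denotes the restriction to inputs whose graph is a tree. Competitive ratio: for an input sequence $\sigma$, let $\mathrm{ALG}(\sigma)$ be the (expected, for randomized algorithms) number of edges colored by ALG and $\mathrm{OPT}(\sigma)$ the maximum number of edges of the input graph that can be properly colored with $k$ colors. ALG is $C$-competitive if there is a constant $b$ with $\mathrm{ALG}(\sigma)\ge C\cdot\mathrm{OPT}(\sigma)-b$ for all inputs $\sigma$; the competitive ratio $C_{\mathrm{ALG}}^{\text{Tree}}(k)$ is the supremum of all such $C$. An algorithm is fair if it never rejects an edge unless all $k$ colors are already used on edges adjacent to it. Next-Fit (NF) remembers the last used color $c_{\text{last}}$ and colors each arriving edge with the first available color in the order $c_{\text{last}}+1,\dots,k,1,\dots,c_{\text{last}}$, rejecting it if none is available; the very first edge gets color 1. *)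

(* Defs.v *)
From HB Require Import structures.
From mathcomp Require Import all_boot all_order all_algebra.
From mathcomp Require Import all_classical all_reals all_analysis.

Set Implicit Arguments.
Unset Strict Implicit.
Unset Printing Implicit Defensive.

Import Order.TTheory GRing.Theory Num.Theory.

(** Vertices are labelled by natural numbers.  The order of the two endpoints
    of an edge carries no meaning: every predicate below is symmetric in it. *)
Definition edge : Type := (nat * nat)%type.

Definition adjacent (e f : edge) : bool :=
  [|| e.1 == f.1, e.1 == f.2, e.2 == f.1 | e.2 == f.2].

Definition same_edge (e f : edge) : bool := (e == f) || (e == (f.2, f.1)).

(** An input is the sequence of its edges in order of arrival.  Its graph has
    the endpoints of these edges as vertex set. *)
Definition vertices (s : seq edge) : seq nat :=
  [seq e.1 | e <- s] ++ [seq e.2 | e <- s].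

Definition linked (s : seq edge) : rel nat :=
  fun u v => ((u, v) \in s) || ((v, u) \in s).

Definition simple_graph (s : seq edge) : Prop :=
  all (fun e => e.1 != e.2) s /\ pairwise (fun e f => ~~ same_edge e f) s.

Definition connected_graph (s : seq edge) : Prop :=
  forall u v, u \in vertices s -> v \in vertices s ->
    exists p, path (linked s) u p /\ last u p = v.

(** [ucycle] is a closed walk without repeated vertices; requiring at least
    three vertices excludes going back and forth along a single edge. *)
Definition acyclic_graph (s : seq edge) : Prop :=
  forall c, ucycle (linked s) c -> size c <= 2.

(** Only the whole input has to be a tree: its prefixes are arbitrary
    forests. *)
Definition is_tree (s : seq edge) : Prop :=
  [/\ simple_graph s, connected_graph s & acyclic_graph s].

(** Partially colored edge sequences; [None] marks an uncolored (rejected)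
    edge, and the colors 1, ..., k are represented by 0, ..., k-1. *)
Definition history (k : nat) : Type := seq (edge * option 'I_k).

Definition proper k (h : history k) : bool :=
  pairwise (fun x y => adjacent x.1 y.1 ==> ((x.2 == None) || (x.2 != y.2))) h.

Definition num_colored k (h : history k) : nat := count (fun x => isSome x.2) h.

Definition opt (k : nat) (s : seq edge) : nat :=
  \max_(t : (size s).-tuple (option 'I_k) | proper (zip s t))
     num_colored (zip s t).

(** A deterministic online algorithm chooses the fate of the arriving edge from
    the edges that arrived before it and the decisions taken on them. *)
Definition policy (k : nat) : Type := history k -> edge -> option 'I_k.

Definition run k (A : policy k) (s : seq edge) : history k :=
  foldl (fun h e => rcons h (e, A h e)) [::] s.

Definition used k (h : history k) (e : edge) : seq 'I_k :=
  pmap (fun x => if adjacent x.1 e then x.2 else None) h.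

Definition online_algorithm k (A : policy k) : Prop :=
  forall s, is_tree s -> proper (run A s).

Definition fair k (A : policy k) : Prop :=
  forall s e t, is_tree (s ++ e :: t) ->
    A (run A s) e = None -> forall c, c \in used (run A s) e.

Definition last_color k (h : history k) : option 'I_k :=
  ohead (rev (pmap snd h)).

(** [rot c.+1 (enum 'I_k)] is c+1, ..., k-1, 0, ..., c. *)
Definition next_fit k : policy k := fun h e =>
  let order := if last_color h is Some c then rot c.+1 (enum 'I_k)
               else enum 'I_k in
  ohead [seq c <- order | c \notin used h e].

(** A randomized online algorithm is a random deterministic one, whose coloring
    of each input is a (discrete) random variable. *)
Definition randomized k (d : measure_display) (T : measurableType d)
    (A : T -> policy k) : Prop :=
  forall s, is_tree s -> forall h : history k,
    measurable [set w | run (A w) s = h]%classic.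

Section CompetitiveRatio.
Variables (R : realType) (k : nat).
Local Open Scope ring_scope.
Local Open Scope ereal_scope.

Definition profit (A : policy k) (s : seq edge) : \bar R :=
  ((num_colored (run A s))%:R : R)%:E.

Definition expected_profit (d : measure_display) (T : measurableType d)
    (P : probability T R) (A : T -> policy k) (s : seq edge) : \bar R :=
  'E_P[fun w => (num_colored (run (A w) s))%:R : R].

Definition competitive (alg : seq edge -> \bar R) (C : R) : Prop :=
  exists b : R, forall s, is_tree s ->
    (C * (opt k s)%:R - b)%:E <= alg s.

Definition competitive_ratio (alg : seq edge -> \bar R) : \bar R :=
  ereal_sup [set C%:E | C in competitive alg]%classic.

End CompetitiveRatio.

Arguments profit R {k} A s.
Arguments competitive_ratio {R} k alg.

(* Main.v *)
(** Lower bound, for every fair algorithm.  A forest can be oriented so that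
    every edge has a child endpoint and no vertex is the child of two edges.
    Let [C] and [H] be the edges colored by the algorithm and by the optimum,
    [c v] the number of edges of [C] at [v], and K = 2n - 2.  The parent
    endpoint [v] of an edge of H \ C pays K - (k - c v) (truncated at 0), and
    the child endpoint covers the rest of a demand of K.  Fairness gives
    c(child) >= k - c(parent), and with q(2n - q) <= n^2 every vertex can
    afford its payments out of its child edges in C (worth 1 each) and in
    C \ H (worth K more).  Summing, K |H \ C| <= |C| + K |C \ H|, that is
    K |H| <= (K + 1) |C|.

    Upper bound, for Next-Fit.  Stars with n(n - 1) edges ("hubs"), followed by
    stars with n edges ("spokes"), are colored cyclically.  The missing colors
    of a hub are exactly the colors of a spoke of the matching residue mod n,
    so any edge joining the two is rejected; in a chain of hubs with n - 1
    child spokes each, n edges per hub are rejected while all degrees stay at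
    most k = n^2. *)

From mathcomp Require Import all_boot all_order all_algebra.
From mathcomp Require Import all_classical all_reals all_analysis.
From mathcomp Require Import zify ring lra.
(* Last, since mathcomp-analysis has an [adjacent] of its own. *)
Require Import Defs.
Import Order.TTheory GRing.Theory Num.Theory.

Set Implicit Arguments.
Unset Strict Implicit.
Unset Printing Implicit Defensive.

(** * Charging along an orientation *)

(** Turns payments counted vertex by vertex into payments counted edge by edge. *)
Lemma sum_fibers (I V : finType) (f : I -> V) (P : pred I) (g : V -> nat) :
  \sum_v (\sum_(i | P i) (f i == v)) * g v = \sum_(i | P i) g (f i).
Proof.
under eq_bigr do rewrite big_distrl.
rewrite exchange_big; apply: eq_bigr => i _.
rewrite (bigD1 (f i)) //= eqxx mul1n big1 ?addn0 // => v.
by rewrite eq_sym => /negbTE ->.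
Qed.

Lemma sum_fibers_dep (I V : finType) (f : I -> V) (P : pred I) (g : I -> nat) :
  \sum_v \sum_(i | P i && (f i == v)) g i = \sum_(i | P i) g i.
Proof.
rewrite (exchange_big_dep P) /=; last by move=> v i _ /andP[].
by apply: eq_bigr => i Pi; rewrite Pi (big_pred1 (f i)) // => v; rewrite eq_sym.
Qed.

Lemma sum_split (I : finType) (P Q : pred I) (g : I -> nat) :
  \sum_(i | P i) g i =
  \sum_(i | P i && Q i) g i + \sum_(i | P i && ~~ Q i) g i.
Proof. by rewrite (bigID Q). Qed.

(** The factors add up to [2 * n], so this is AM-GM; for [q] beyond [2 * n] the truncated factor is
    0. *)
Lemma mul_compl_le_sqr n q : q * (2 * n - q) <= n ^ 2.
Proof.
have [qn|nq] := leqP q (2 * n); last by rewrite (_ : 2 * n - q = 0) ?muln0 //; lia.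
have [a e] : exists a, a = 2 * n - q by exists (2 * n - q).
rewrite -e -(leq_pmul2l (_ : 0 < 4)) // -[4]/(2 ^ 2) -expnMn.
by rewrite (_ : 2 * n = q + a) ?nat_AGM2; lia.
Qed.

(** Budget of a vertex that is the child of an edge of H \ C: [c] and [c'] are the C-degrees of this
    vertex and of its parent, [d] and [f] count the edges of H \ C and of C \ H of which it is the
    parent. With m = n^2 - c and K = 2n - 2, the degree bound reads d + 1 <= m + f. Multiplied by K
    - m and combined with m(K - m) + 2m <= n^2, it leaves room even for the full demand K of the
    child edge. *)
Lemma excess_parent n c c' d f : 0 < n ->
    c <= n ^ 2 -> c' <= n ^ 2 -> n ^ 2 <= c + c' -> c + d + 1 <= n ^ 2 + f ->
  d * (2 * n - 2 - (n ^ 2 - c)) + (2 * n - 2 - (2 * n - 2 - (n ^ 2 - c')))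
    <= c + (2 * n - 2) * f.
Proof.
move=> n0 ck c'k cc' dc.
set m := n ^ 2 - c; set K := 2 * n - 2.
case: (leqP K m) => Km.
  have -> : K - m = 0 by lia.
  by rewrite muln0; lia.
have key := mul_compl_le_sqr n m.
have dm : d + 1 <= m + f by lia.
have h1 : (d + 1) * (K - m) <= (m + f) * (K - m) by rewrite leq_mul2r dm orbT.
have h2 : f * (K - m) <= f * K by rewrite leq_mul2l leq_subr orbT.
have e2 : 2 * n - m = (K - m) + 2 by lia.
by move: key h1; rewrite e2 !mulnDl mulnDr mul1n (mulnC K f); lia.
Qed.

(** Budget of a vertex that is the child of no edge of H \ C. Here [b] and [b'] count the edges of C
    and of C \ H of which it is the child. Such an edge is income of its parent endpoint only, hence
    [b] on the left; AM-GM is now taken at m + b. *)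
Lemma excess_root n c d f b b' : 0 < n ->
    c <= n ^ 2 -> c + d <= n ^ 2 + f + b' -> b' <= b -> b <= 1 -> b <= c ->
  b + d * (2 * n - 2 - (n ^ 2 - c)) <= c + (2 * n - 2) * f.
Proof.
move=> n0 ck dc b'b b1 bc.
set m := n ^ 2 - c; set K := 2 * n - 2.
case: (leqP K m) => Km.
  have -> : K - m = 0 by lia.
  by rewrite muln0; lia.
have key := mul_compl_le_sqr n (m + b).
have dm : d <= m + f + b by lia.
have h1 : d * (K - m) <= (m + f + b) * (K - m) by rewrite leq_mul2r dm orbT.
have h2 : f * (K - m) <= f * K by rewrite leq_mul2l leq_subr orbT.
have e2 : 2 * n - (m + b) = (K - m) + (2 - b) by lia.
have n1 : n ^ 2 > 0 by rewrite expn_gt0 n0.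
move: key h1; rewrite e2 !mulnDl !mulnDr (mulnC K f).
have : b = 0 \/ b = 1 by lia.
by case=> ->; lia.
Qed.

Lemma orientation_bound (I V : finType) (ch pa : I -> V) (C H : pred I)
    (n : nat) (deg : pred I -> V -> nat) :
    (forall P v, deg P v = \sum_(i | P i) ((ch i == v) + (pa i == v))) ->
    2 <= n -> injective ch ->
    (forall v, deg C v <= n ^ 2) -> (forall v, deg H v <= n ^ 2) ->
    (forall i, ~~ C i -> n ^ 2 <= deg C (ch i) + deg C (pa i)) ->
  (2 * n - 2) * #|H| <= (2 * n - 1) * #|C|.
Proof.
move=> degE n2 chI degC degH rej.
set K := 2 * n - 2.
pose D i := H i && ~~ C i; pose F i := C i && ~~ H i.
pose cnt (f : I -> V) (P : pred I) v := \sum_(i | P i) (f i == v).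
pose pay v := K - (n ^ 2 - deg C v).
have degD P v : deg P v = cnt ch P v + cnt pa P v by rewrite degE big_split.
have chb P v : cnt ch P v <= 1.
  case: (pickP (fun i => ch i == v)) => [i /eqP <-|no].
    rewrite /cnt big_mkcond (bigD1 i) //= big1 ?eqxx ?addn0; first by case: (P i).
    by move=> j /negbTE ji; rewrite (inj_eq chI) ji if_same.
  by rewrite /cnt big1 // => i _; rewrite no.
(* Left: what [v] pays as parent and as child of edges of H \ C. Right: its income from the edges of
   C and C \ H of which it is the parent. *)
have local v : cnt pa D v * pay v
      + \sum_(i | D i && (ch i == v)) (K - pay (pa i))
    <= cnt pa C v + K * cnt pa F v.
  have hH f : cnt f H v + cnt f F v = cnt f C v + cnt f D v.
    rewrite /cnt (sum_split H C) (sum_split C H).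
    rewrite (eq_bigl (fun i => C i && H i)) => [|i]; last by rewrite andbC.
    by rewrite -!addnA; congr addn; rewrite addnC.
  have := degC v; have := degH v; have := degD C v; have := degD H v.
  have := hH ch; have := hH pa; have := chb C v; have := chb F v.
  (* A child of an edge of H \ C is, by injectivity of [ch], the child of no edge of C, so its whole
     C-degree is income. *)
  case: (pickP (fun i => D i && (ch i == v))) => [i /andP[Di /eqP iv]|no].
    have cC0 : cnt ch C v = 0.
      rewrite /cnt big1 // => j Cj; case: eqP => // jv.
      by move: Di; rewrite /D (chI i j) ?iv // Cj andbF.
    have cF0 : cnt ch F v = 0.
      rewrite /cnt big1 // => j /andP[Cj _]; case: eqP => // jv.
      by move: Di; rewrite /D (chI i j) ?iv // Cj andbF.
    have cD1 : cnt ch D v = 1.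
      rewrite /cnt (bigD1 i) //= iv eqxx big1 // => j /andP[_ ji].
      by rewrite -iv (inj_eq chI) (negbTE ji).
    rewrite cC0 cF0 cD1.
    rewrite (big_pred1 i) => [|j] /=; last first.
      apply/andP/eqP => [[_ /eqP jv]|->]; last by rewrite Di iv.
      by apply: chI; rewrite jv.
    have rejv : n ^ 2 <= deg C v + deg C (pa i).
      by rewrite -{1}iv; apply: rej; case/andP: Di.
    move=> _ _ hpa hch eH eC hv cv.
    rewrite (_ : cnt pa C v = deg C v); last by rewrite eC.
    by apply: excess_parent; rewrite ?degC //; lia.
  rewrite big_pred0 // addn0.
  have cD0 : cnt ch D v = 0.
    by rewrite /cnt big1 // => i Di; have /= := no i; rewrite Di /= => ->.
  rewrite cD0 => _ cC1 hpa hch eH eC hv cv.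
  rewrite -(leq_add2l (cnt ch C v)) [leqRHS]addnA -eC.
  by apply: (excess_root (b' := cnt ch F v)); lia.
have cardE (f : I -> V) P : \sum_v cnt f P v = \sum_(i | P i) 1.
  rewrite -(sum_fibers f P (fun=> 1)).
  by apply: eq_bigr => v _; rewrite muln1.
have : K * \sum_(i | D i) 1 <= \sum_(i | C i) 1 + K * \sum_(i | F i) 1.
  rewrite -(cardE pa C) -(cardE pa F) !big_distrr -big_split /=.
  apply: leq_trans; last by apply: leq_sum => v _; exact: local.
  rewrite big_split sum_fibers sum_fibers_dep -big_split /=.
  by apply: leq_sum => i _; rewrite muln1 subnKC // /pay leq_subr.
have eqD : \sum_(i | H i) 1 = \sum_(i | C i && H i) 1 + \sum_(i | D i) 1.
  rewrite (sum_split H C); congr addn.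
  by apply: eq_bigl => i; rewrite andbC.
have eqF : \sum_(i | C i) 1 = \sum_(i | C i && H i) 1 + \sum_(i | F i) 1.
  exact: sum_split.
rewrite -!sum1_card eqD eqF /K.
move: (\sum_(i | D i) 1) (\sum_(i | F i) 1) (\sum_(i | C i && H i) 1) => d f c.
lia.
Qed.

(** * Orienting forests *)

Lemma linked_sym s : symmetric (linked s).
Proof. by move=> u v; rewrite /linked orbC. Qed.

Lemma linked_vertices s u v : linked s u v -> u \in vertices s.
Proof.
rewrite /vertices mem_cat => /orP[] /[dup] h; [move/(map_f fst)|move/(map_f snd)].
  by move=> /= ->.
by move=> /= ->; rewrite orbT.
Qed.

Lemma same_edge_sym : symmetric same_edge.
Proof.
move=> [a b] [c d]; rewrite /same_edge !xpair_eqE /=.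
by rewrite ![_ == a]eq_sym ![_ == b]eq_sym [X in _ || X]andbC.
Qed.

Lemma simple_graph_inj s e f : simple_graph s -> e \in s -> f \in s ->
  same_edge e f -> e = f.
Proof.
case=> _; elim: s => //= x s IH /andP[/allP xs /IH ps]; rewrite !inE.
move=> /predU1P[->|es] /predU1P[->|fs] // ef; last exact: ps.
  by have := xs _ fs; rewrite ef.
by have := xs _ es; rewrite same_edge_sym ef.
Qed.

Lemma simple_graph_uniq s : simple_graph s -> uniq s.
Proof.
case=> _; rewrite uniq_pairwise; apply: sub_pairwise => e f.
by apply: contra => /eqP ->; rewrite /same_edge eqxx.
Qed.

Lemma simple_graph_sub s s' : subseq s' s -> simple_graph s -> simple_graph s'.
Proof.
move=> ss [/allP a p]; split; last exact: subseq_pairwise ss p.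
by apply/allP => e /(mem_subseq ss)/a.
Qed.

Lemma acyclic_graph_sub s s' : {subset s' <= s} ->
  acyclic_graph s -> acyclic_graph s'.
Proof.
move=> ss ac c /andP[cc cu]; apply: ac; apply/andP; split=> //.
apply: sub_cycle cc => u v.
by rewrite /linked => /orP[/ss ->|/ss ->]; rewrite ?orbT.
Qed.

(** A simple path is extended at its head. A neighbor of the head other than its successor either
    prolongs the path or closes a cycle of at least three vertices; as there are finitely many
    vertices, some head has no such neighbor. *)
Lemma acyclic_leaf s : simple_graph s -> acyclic_graph s -> s != [::] ->
  exists v w, linked s v w /\ forall z, linked s v z -> z = w.
Proof.
move=> [/allP noloop _] ac; case: s => [//|[a b] s'] in noloop ac *.
set s := _ :: s' in noloop ac * => _.
(* [m] is fuel: at 0 the path [v :: w :: p] would have more distinct vertices than the graph. *)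
have ext m v w p : size (undup (vertices s)) < size p + m ->
    path (linked s) v (w :: p) -> uniq (v :: w :: p) ->
    exists v w, linked s v w /\ forall z, linked s v z -> z = w.
  elim: m v w p => [|m IH] v w p szp pvw uvw.
    have /uniq_leq_size : {subset v :: w :: p <= undup (vertices s)}.
      move=> x; rewrite mem_undup.
      have lnk y q : path (linked s) y q -> {subset q <= vertices s}.
        elim: q y => //= t q IHq y /andP[yt tq] z; rewrite inE.
        case/predU1P=> [->|]; last exact: IHq tq z.
        by apply: (linked_vertices (v := y)); rewrite linked_sym.
      rewrite inE => /predU1P[->|]; last exact: (lnk _ _ pvw).
      by case/andP: pvw => /linked_vertices.
    by move/(_ uvw); rewrite /= in szp *; lia.
  case: (pselect (exists2 z, linked s v z & z != w)) => [[z vz zw]|no]; last first.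
    exists v, w; split; first by case/andP: pvw.
    by move=> z vz; apply: contrapT => /eqP zw; apply: no; exists z.
  have zv : z != v.
    by apply: contraTneq vz => ->; rewrite /linked orbb;
       apply/negP => /noloop /=; rewrite eqxx.
  case: (boolP (z \in p)) => [zp|zp].
    case/splitPr: zp pvw uvw => p1 p2 pvw uvw {szp}.
    have /ac : ucycle (linked s) (v :: w :: rcons p1 z).
      have subs : subseq (v :: w :: rcons p1 z) (v :: w :: p1 ++ z :: p2).
        by rewrite -cat_rcons -!cat_cons prefix_subseq.
      apply/andP; split; last exact: subseq_uniq subs uvw.
      move: pvw; rewrite -cat_rcons -cat_cons cat_path => /andP[pvw _].
      rewrite /cycle rcons_path pvw /= last_rcons.
      by rewrite linked_sym.
    by rewrite /= size_rcons.
  apply: (IH z v (w :: p)); first by move: szp; rewrite /=; lia.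
    by rewrite /= linked_sym vz.
  by rewrite [uniq _]/= inE negb_or zv inE negb_or zw zp.
apply: (ext (size (undup (vertices s))).+1 a b [::]) => //=.
  by rewrite andbT /linked inE eqxx.
by rewrite andbT inE; apply: (noloop (a, b)); rewrite inE eqxx.
Qed.

(** Induction on the number of edges: remove the edge [e0] at a leaf [v] and make [v] its child. No
    remaining edge touches [v], so injectivity survives. *)
Lemma acyclic_orientation s : simple_graph s -> acyclic_graph s ->
  exists ch : edge -> nat, {in s &, injective ch} /\
    {in s, forall e, (ch e == e.1) || (ch e == e.2)}.
Proof.
move: {2}(size s) (leqnn (size s)) => m.
elim: m s => [|m IH] s sz ss ac.
  by exists fst; move: sz; rewrite leqn0 => /nilP ->.
have [->|s0] := eqVneq s [::]; first by exists fst.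
have [v [w [vw leaf]]] := acyclic_leaf ss ac s0.
have [e0 [es0 ve0 e0P]] : exists e0, [/\ e0 \in s, (v == e0.1) || (v == e0.2) &
    {in s, forall e, (v == e.1) || (v == e.2) -> e = e0}].
  have [e0 [es0 he0]] : exists e0, e0 \in s /\ same_edge (v, w) e0.
    case/orP: vw => h; [exists (v, w)|exists (w, v)]; split => //.
      by rewrite /same_edge eqxx.
    by rewrite /same_edge eqxx orbT.
  exists e0; split => //.
    by case/orP: he0 => /eqP; case: (e0) => a b [-> _] /=; rewrite eqxx ?orbT.
  move=> e es ve; apply: (simple_graph_inj ss) => //.
  have : same_edge e (v, w).
    case: e es ve => a b es /= /orP[] /eqP va; subst v.
      have -> : b = w by apply: leaf; rewrite /linked es.
      by rewrite /same_edge eqxx.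
    have -> : a = w by apply: leaf; rewrite /linked es orbT.
    by rewrite /same_edge eqxx orbT.
  move: he0; rewrite /same_edge; case: (e0) => c d; case: (e) => a b /=.
  rewrite !xpair_eqE => /orP[] /andP[/eqP -> /eqP ->] // /orP[] /andP[-> ->];
    by rewrite ?orbT.
have us := simple_graph_uniq ss.
have sub := rem_subseq e0 s.
have szr : size (rem e0 s) <= m by rewrite size_rem // -subn1 leq_subLR add1n.
have [||ch [chI chP]] := IH (rem e0 s) szr.
- exact: simple_graph_sub sub ss.
- by apply: acyclic_graph_sub ac; exact: mem_subseq.
have memr e : e \in s -> e != e0 -> e \in rem e0 s.
  by move=> es ee; rewrite mem_rem_uniq // !inE ee.
have chv e : e \in s -> e != e0 -> ch e != v.
  move=> es ee; apply/eqP => cv; case/eqP: (ee); apply: e0P => //.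
  by have := chP _ (memr _ es ee); rewrite cv.
exists (fun e => if e == e0 then v else ch e); split; last first.
  move=> e es /=; case: (eqVneq e e0) => [->//|ee]; exact: chP _ (memr _ es ee).
move=> e f es fs /=.
case: (eqVneq e e0) => [->|ee]; case: (eqVneq f e0) => [->|fe] //.
- by move=> h; have := chv _ fs fe; rewrite -h eqxx.
- by move=> h; have := chv _ es ee; rewrite h eqxx.
- by apply: chI; exact: memr.
Qed.

(** * Fair colorings *)

Definition incident (v : nat) (e : edge) : bool := (e.1 == v) || (e.2 == v).

Lemma incident_adjacent v e f : incident v e -> incident v f -> adjacent e f.
Proof.
by rewrite /adjacent => /orP[]/eqP -> /orP[]/eqP ->; rewrite eqxx ?orbT.
Qed.

Lemma adjacent_sym : symmetric adjacent.
Proof.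
move=> [a b] [c d]; rewrite /adjacent /= ![c == _]eq_sym ![d == _]eq_sym.
by congr orb; rewrite orbCA.
Qed.

Lemma proper_neq k (h : history k) x i j : proper h ->
    i < size h -> j < size h -> i != j -> adjacent (nth x h i).1 (nth x h j).1 ->
  isSome (nth x h i).2 -> (nth x h i).2 != (nth x h j).2.
Proof.
move=> /(pairwiseP x) ph ih jh; rewrite neq_ltn => /orP[] ij aij ci.
  by have := ph _ _ ih jh ij; rewrite aij /=; case: (nth x h i).2 ci.
have := ph _ _ jh ih ij; rewrite adjacent_sym aij /=.
by case/orP => [/eqP ->|]; [case: (nth x h i).2 ci|rewrite eq_sym].
Qed.

Lemma num_coloredE k (h : history k) x :
  num_colored h = #|[pred i : 'I_(size h) | isSome (nth x h i).2]|.
Proof.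
by rewrite -sum1_card /num_colored -sum1_count (big_nth x) big_mkord.
Qed.

(** Colored edges at one vertex are pairwise adjacent, so their colors are distinct. *)
Lemma card_incident_le k (h : history k) x v : proper h ->
  #|[pred i : 'I_(size h) | isSome (nth x h i).2 && incident v (nth x h i).1]|
    <= k.
Proof.
move=> ph; set A := [pred i | _].
rewrite -(card_in_image (f := fun i : 'I_(size h) => (nth x h i).2) (A := A)).
  rewrite -[leqRHS](card_ord k) -(card_codom (f := @Some 'I_k)).
  2: by move=> ? ? [].
  apply: subset_leq_card; apply/fintype.subsetP => o /fintype.imageP[i].
  rewrite inE => /andP[+ _] ->.
  by case: (nth x h i).2 => // c _; apply: codom_f.
move=> i j /andP[ci vi] /andP[cj vj] cij; apply/eqP/negPn/negP => ij.
have := proper_neq ph (ltn_ord i) (ltn_ord j) ij (incident_adjacent vi vj) ci.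
by rewrite cij eqxx.
Qed.

(** Instance of [orientation_bound] in which edges are positions in [s]. Of the algorithm only its
    final coloring [h] remains, with fairness stated on it; [h'] is any competing coloring. *)
Lemma fair_coloring_bound n k (s : seq edge) (h h' : history k) :
    2 <= n -> k = n ^ 2 -> is_tree s -> unzip1 h = s -> unzip1 h' = s ->
    proper h -> proper h' ->
    (forall e, (e, None) \in h -> forall c,
       exists2 f, (f, Some c) \in h & adjacent f e) ->
  (2 * n - 2) * num_colored h' <= (2 * n - 1) * num_colored h.
Proof.
move=> n2 kn [ss _ ac] hs hs' ph ph' rej.
have [ch [chI chP]] := acyclic_orientation ss ac.
have szh : size h = size s by rewrite -hs size_map.
have szh' : size h' = size s by rewrite -hs' size_map.
pose x : edge * option 'I_k := ((0, 0), None).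
rewrite (num_coloredE h x) (num_coloredE h' x); rewrite szh szh'.
pose e (i : 'I_(size s)) := nth x.1 s i.
have nth1 (g : history k) j : unzip1 g = s -> j < size s ->
    (nth x g j).1 = nth x.1 s j.
  by move=> <-; rewrite size_map => jg; rewrite (nth_map x).
have eh (i : 'I_(size s)) : (nth x h i).1 = e i by exact: nth1.
have es i : e i \in s by exact: mem_nth.
(* The largest label bounds all endpoints, which makes the vertex set the finite type ['I_N.+1]. *)
pose N := \max_(v <- vertices s) v.
have vN i : (e i).1 < N.+1 /\ (e i).2 < N.+1.
  rewrite !ltnS; split; apply: (leq_bigmax_seq (F := id)) => //;
    by rewrite mem_cat map_f ?orbT.
have chN i : ch (e i) < N.+1.
  by have [? ?] := vN i; case/orP: (chP _ (es i)) => /eqP ->.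
pose chi i : 'I_N.+1 := inord (ch (e i)).
pose pai i : 'I_N.+1 := inord (if ch (e i) == (e i).1 then (e i).2 else (e i).1).
have noloop i : (e i).1 != (e i).2.
  by case: ss => /allP + _ => /(_ _ (es i)).
have inord_eq a (v : 'I_N.+1) : a < N.+1 -> (inord a == v) = (a == v :> nat).
  by move=> aN; rewrite -val_eqE /= inordK.
have incE i v : (chi i == v) + (pai i == v) = incident v (e i) :> nat.
  have [n1 n2'] := vN i; rewrite /chi /pai /incident.
  have := chP _ (es i); have := noloop i.
  case: (eqVneq (ch (e i)) (e i).1) => [-> ne _|ce ne /= /eqP ->];
    rewrite !inord_eq //.
    by case: (eqVneq (e i).1 v) ne => [->|]; case: (eqVneq (e i).2 v) => // ->;
      rewrite ?eqxx.
  by case: (eqVneq (e i).1 v) ne => [->|]; case: (eqVneq (e i).2 v) => // ->;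
    rewrite ?eqxx.
pose deg (P : pred 'I_(size s)) (v : 'I_N.+1) :=
  #|[pred i | P i && incident v (e i)]|.
pose C i := isSome (nth x h (val (i : 'I_(size s)))).2.
pose H i := isSome (nth x h' (val (i : 'I_(size s)))).2.
have degk (g : history k) : unzip1 g = s -> proper g -> forall v : nat,
    #|[pred i : 'I_(size s) | isSome (nth x g i).2 && incident v (e i)]| <= k.
  move=> gs pg v; have szg : size g = size s by rewrite -gs size_map.
  have := card_incident_le x v pg; rewrite szg; apply: leq_trans.
  rewrite leq_eqVlt; apply/orP; left; apply/eqP; apply: eq_card => i.
  by rewrite !inE nth1.
have -> : #|[pred i : 'I_(size s) | isSome (nth x h' i).2]| = #|H| by [].
have -> : #|[pred i : 'I_(size s) | isSome (nth x h i).2]| = #|C| by [].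
apply: (orientation_bound (ch := chi) (pa := pai) (deg := deg)) => //.
- move=> P v; rewrite /deg -sum1_card big_mkcondr /=.
  by apply: eq_bigr => i _; rewrite incE; case: incident.
- move=> i j ij; apply: val_inj; apply/eqP.
  rewrite -(nth_uniq x.1 (ltn_ord i) (ltn_ord j) (simple_graph_uniq ss)); apply/eqP.
  apply: chI; [exact: es|exact: es|].
  by have /= := congr1 val ij; rewrite /chi /= !inordK ?chN.
- by move=> v; rewrite -kn; exact: degk.
- by move=> v; rewrite -kn; exact: degk.
move=> i Ci; rewrite -kn -[leqLHS](card_ord k).
have ri : (e i, None) \in h.
  have -> : (e i, None) = nth x h i.
    rewrite -eh; move: Ci; rewrite /C; case: (nth x h i) => ? [] //.
  by apply: mem_nth; rewrite szh.
pose col (j : 'I_(size s)) := (nth x h j).2.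
(* Each of the [k] colors occurs at an endpoint of the rejected edge, so the color sets at the two
   endpoints together cover all colors, and their sizes are at most the C-degrees. *)
apply: leq_trans (leq_add (leq_image_card col _) (leq_image_card col _)).
rewrite -cardUI -(card_codom (f := @Some 'I_k)); last by move=> ? ? [].
apply: leq_trans (leq_addr _ _); apply: subset_leq_card.
apply/fintype.subsetP => _ /codomP[c ->].
have [f fh fe] := rej _ ri c.
have jsz : index (f, Some c) h < size s by rewrite -szh index_mem.
pose j := Ordinal jsz.
have hj : nth x h j = (f, Some c) by rewrite nth_index.
have ej : e j = f by rewrite -eh hj.
have -> : Some c = col j by rewrite /col hj.
have Cj : C j by rewrite /C hj.
have inc y : y <= N -> incident y f -> col j \in [seq col i0 | i0 in
    [pred i0 | C i0 && incident (inord y : 'I_N.+1) (e i0)]].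
  by move=> yN yf; apply: fintype.image_f; rewrite inE Cj inordK // ej.
rewrite inE; have [n1 n2'] := vN i; have ip := chP _ (es i).
have : incident (e i).1 f || incident (e i).2 f.
  by move: fe; rewrite /adjacent /incident -!orbA => /or4P[] ->; rewrite ?orbT.
rewrite /chi /pai; case: (eqVneq (ch (e i)) (e i).1) ip => [-> _|_ /= /eqP ->].
  by case/orP => ?; apply/orP; [left|right]; exact: inc.
by case/orP => ?; apply/orP; [right|left]; exact: inc.
Qed.

(** * Online runs *)

Lemma run_rcons k (A : policy k) s e :
  run A (rcons s e) = rcons (run A s) (e, A (run A s) e).
Proof. by rewrite /run -cats1 foldl_cat. Qed.

Lemma unzip1_run k (A : policy k) s : unzip1 (run A s) = s.
Proof.
elim/last_ind: s => // s e IH.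
by rewrite run_rcons -cats1 /unzip1 map_cat [map _ _]IH cats1.
Qed.

Lemma run_cat k (A : policy k) s t : exists h, run A (s ++ t) = run A s ++ h.
Proof.
elim/last_ind: t => [|t e [h IH]]; first by exists [::]; rewrite !cats0.
by rewrite -rcons_cat run_rcons IH rcons_cat; eexists.
Qed.

Lemma mem_run k (A : policy k) s x : x \in run A s ->
  exists pre post, s = pre ++ x.1 :: post /\ A (run A pre) x.1 = x.2.
Proof.
elim/last_ind: s => // s e IH; rewrite run_rcons mem_rcons inE.
case/predU1P => [->|/IH [pre [post [-> Apre]]]].
  by exists s, [::]; rewrite cats1.
by exists pre, (rcons post e); rewrite -rcons_cons rcons_cat.
Qed.

Lemma usedP k (h : history k) e c :
  reflect (exists2 f, (f, Some c) \in h & adjacent f e) (c \in used h e).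
Proof.
rewrite mem_pmap; apply: (iffP mapP) => [[[f o] fh /=]|[f fh fe]].
  by case: ifP => // fe oc; exists f; rewrite // oc.
by exists (f, Some c) => //=; rewrite fe.
Qed.

Lemma fair_run_bound n k (A : policy k) s :
    2 <= n -> k = n ^ 2 -> online_algorithm A -> fair A -> is_tree s ->
  (2 * n - 2) * opt k s <= (2 * n - 1) * num_colored (run A s).
Proof.
move=> n2 kn onA fA ts; rewrite /opt.
have bound t : proper (zip s (val (t : (size s).-tuple (option 'I_k)))) ->
  (2 * n - 2) * num_colored (zip s t) <= (2 * n - 1) * num_colored (run A s).
  move=> pt; apply: (fair_coloring_bound n2 kn ts) => //.
  - exact: unzip1_run.
  - by rewrite unzip1_zip // size_tuple.
  - exact: onA.
  move=> e eN c; have [pre [post /= [sE AN]]] := mem_run eN.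
  have /usedP [f fh fe] : c \in used (run A pre) e.
    by apply: (fA _ _ post) => //; rewrite -sE.
  (* A color in use when [e] was rejected is still present in the final history. *)
  exists f => //; rewrite sE.
  by have [h ->] := run_cat A pre (e :: post); rewrite mem_cat fh.
apply: (big_ind (fun m => (2 * n - 2) * m <= _)) => [|a b ha hb|t].
- by rewrite muln0.
- by rewrite maxnMr geq_max ha.
- exact: bound.
Qed.

Lemma opt_ge k s (t : seq (option 'I_k)) : size t = size s -> proper (zip s t) ->
  num_colored (zip s t) <= opt k s.
Proof.
move=> st pt; rewrite /opt.
exact: (leq_bigmax_cond (P := fun t : (size s).-tuple _ => proper (zip s t))
  (F := fun t : (size s).-tuple _ => num_colored (zip s t)) (Tuple (introT eqP st))).
Qed.

Lemma num_colored_run_cat_le k (A : policy k) s t :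
  num_colored (run A (s ++ t)) <= num_colored (run A s) + size t.
Proof.
elim/last_ind: t => [|t e IH]; first by rewrite cats0 addn0.
rewrite -rcons_cat run_rcons size_rcons /num_colored -cats1 count_cat /=.
by rewrite addn0 addnS -addn1 leq_add //; case: (A _ _).
Qed.

Lemma num_colored_run_rejected k (A : policy k) s t :
    (forall pre e post, t = pre ++ e :: post -> A (run A (s ++ pre)) e = None) ->
  num_colored (run A (s ++ t)) = num_colored (run A s).
Proof.
elim/last_ind: t => [|t e IH] rej; first by rewrite cats0.
rewrite -rcons_cat run_rcons (rej t e [::]) ?cats1 //.
rewrite -IH /num_colored -?cats1 ?count_cat ?addn0 // => pre f post tE.
by apply: (rej pre f (rcons post e)); rewrite tE rcons_cat.
Qed.

Lemma next_fit_notin_used k (h : history k) e c :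
  next_fit h e = Some c -> c \notin used h e.
Proof.
rewrite /next_fit; case: last_color => [d|] /=.
  case E : [seq _ <- _ | _] => [//|c' l] [<-].
  by have := mem_head c' l; rewrite -E mem_filter => /andP[].
case E : [seq _ <- _ | _] => [//|c' l] [<-].
by have := mem_head c' l; rewrite -E mem_filter => /andP[].
Qed.

Lemma next_fit_NoneP k (h : history k) e :
  reflect (forall c, c \in used h e) (next_fit h e == None).
Proof.
apply: (iffP eqP) => [+ c|used_all]; rewrite /next_fit; last first.
  rewrite /= (eq_filter (a2 := pred0)) ?filter_pred0 //.
  by move=> c /=; rewrite used_all.
move=> E; apply/negPn/negP => cu.
have : c \in (if last_color h is Some c then rot c.+1 (enum 'I_k) else enum 'I_k).
  by case: last_color => [d|]; rewrite ?mem_rot mem_enum.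
move: E; move: (if _ is Some _ then _ else _) => l; elim: l => //= a l IH.
case: ifP => // /negbFE au lN; rewrite inE => /predU1P[ca|]; last exact: IH.
by move: cu; rewrite ca au.
Qed.

Lemma next_fit_online k : online_algorithm (@next_fit k).
Proof.
move=> s _; elim/last_ind: s => // s e IH; rewrite run_rcons.
rewrite /proper pairwise_rcons; apply/andP; split; last exact: IH.
apply/allP => -[f o] fh /=.
apply/implyP => fe; case: o fh => // c fh /=.
case E : next_fit => [d|] //; apply: contra (next_fit_notin_used E) => /eqP[<-].
by apply/usedP; exists f.
Qed.

Lemma next_fit_fair k : fair (@next_fit k).
Proof. by move=> s e t _ /eqP/next_fit_NoneP. Qed.

(** * Cyclic runs of Next-Fit and trees given by parents *)

Lemma next_fit_head k (h : history k) e c l :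
    (if last_color h is Some d then rot d.+1 (enum 'I_k) else enum 'I_k)
      = c :: l ->
    c \notin used h e ->
  next_fit h e = Some c.
Proof. by rewrite /next_fit => -> /= ->. Qed.

(** Color [m %% k] was last given [k] steps before edge [m]. If adjacent edges arrive less than [k]
    steps apart, it is free again, and Next-Fit never skips a color. *)
Lemma next_fit_cyclic k (f : nat -> edge) m : 0 < k ->
    (forall i j, i < j < m -> adjacent (f i) (f j) -> j - i < k) ->
  run (@next_fit k) [seq f t | t <- iota 0 m] =
  [seq (f t, insub (t %% k)) | t <- iota 0 m].
Proof.
move=> k0; elim: m => // m IH adj.
have colE t : insub (t %% k) = Some (Ordinal (ltn_pmod t k0)).
  by rewrite insubT ?ltn_pmod // => h; congr Some; apply: val_inj.
rewrite -addn1 iotaD !map_cat /= !add0n cats1 run_rcons IH; last first.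
  by move=> i j ij; apply: adj; lia.
rewrite cats1; congr rcons; congr pair; rewrite colE.
set h := [seq _ | t <- _]; set c := Ordinal _.
have cu : c \notin used h (f m).
  apply/negP => /usedP [e /mapP[t]]; rewrite mem_iota add0n colE => tm [-> [tc]] a.
  have tmk : m - t < k by apply: adj a; lia.
  have := divn_eq m k; have := divn_eq t k; rewrite -tc.
  move: (m %/ k) (t %/ k) (m %% k) => a1 a2 r e2 e1.
  have : m - t = (a1 - a2) * k by rewrite mulnBl; lia.
  by case: (a1 - a2) => [|d]; rewrite ?mulSn; lia.
suff [l lE] : exists l, (if last_color h is Some d then rot d.+1 (enum 'I_k)
    else enum 'I_k) = c :: l by apply: next_fit_head lE cu.
have hd (s : seq 'I_k) : 0 < size s -> nth c s 0 = c -> exists l, s = c :: l.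
  by case: s => //= a s _ ->; exists s.
have szk := size_enum_ord k.
case: m IH adj @h @c cu hd => [|m] IH adj h c cu hd.
  apply: hd; first by rewrite szk.
  by apply: val_inj; rewrite /= nth_enum_ord //= mod0n.
have -> : last_color h = Some (Ordinal (ltn_pmod m k0)).
  rewrite /last_color /h -(addn1 m) iotaD map_cat pmap_cat rev_cat.
  by rewrite add0n /= colE.
apply: hd; first by rewrite size_rot szk.
apply: val_inj; rewrite /rot nth_cat size_drop szk /= subn_gt0 sub0n.
have mS : (m %% k).+1 %% k = m.+1 %% k by rewrite -addn1 modnDml addn1.
(* If [(m %% k).+1] equals [k], the rotation is the identity and the order restarts at color 0. *)
case: (ltnP (m %% k).+1 k) => mk.
  by rewrite nth_drop addn0 nth_enum_ord // -mS [RHS]modn_small.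
rewrite seq.nth_take // nth_enum_ord // -mS.
have -> : (m %% k).+1 = k by have := ltn_pmod m k0; lia.
by rewrite modnn.
Qed.

Definition parent_tree (U : countType) (par : U -> U) (us : seq U) : seq edge :=
  [seq (pickle u, pickle (par u)) | u <- us].

(** Following parents lowers the rank and so ends at the root, which gives connectedness. On a
    cycle, both neighbors of a vertex of maximal rank would have to be its parent. *)
Lemma parent_tree_is_tree (U : countType) (par : U -> U) (us : seq U)
    (root : U) (rank : U -> nat) :
    uniq us -> root \notin us ->
    {in us, forall u, rank (par u) < rank u} ->
    {in us, forall u, par u \in root :: us} ->
  is_tree (parent_tree par us).
Proof.
move=> uus rus rk pus; set s := parent_tree par us.
have pkI : injective (@pickle U) := pcan_inj pickleK.
have linkP x y : linked s x y -> exists2 u, u \in us &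
    x = pickle u /\ y = pickle (par u) \/ y = pickle u /\ x = pickle (par u).
  by case/orP => /mapP[u uu [-> ->]]; exists u; tauto.
split.
- split.
    apply/allP => _ /mapP[u uu ->] /=; rewrite (inj_eq pkI).
    by apply: contraTneq (rk _ uu) => <-; rewrite ltnn.
  rewrite /s /parent_tree pairwise_map.
  apply: (sub_in_pairwise (P := mem us) (r := fun u v => u != v)).
  + move=> u v uu vu /= uv; rewrite /same_edge /= !xpair_eqE !(inj_eq pkI).
    rewrite (negbTE uv) /=; apply/negP => /andP[/eqP upv /eqP puv].
    have := rk _ uu; have := rk _ vu; rewrite -upv puv; lia.
  + exact/allP.
  + by rewrite -uniq_pairwise.
- pose conn x y := exists p, path (linked s) x p /\ last x p = y.
  have conn_trans x y z : conn x y -> conn y z -> conn x z.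
    move=> [p [pp <-]] [q [qp <-]]; exists (p ++ q).
    by rewrite cat_path pp qp last_cat.
  have conn_sym x y : conn x y -> conn y x.
    move=> [p [pp <-]]; exists (rev (belast x p)); split.
      rewrite rev_path; apply: sub_path pp => a b; by rewrite linked_sym.
    by case: p pp => //= a p _; rewrite rev_cons last_rcons.
  have to_root u : u \in root :: us -> conn (pickle u) (pickle root).
    move: {2}(rank u) (leqnn (rank u)) => m; elim: m u => [|m IH] u um.
      rewrite inE => /predU1P[->|/rk]; [by exists [::]|lia].
    rewrite inE => /predU1P[->|uu]; first by exists [::].
    apply: (conn_trans _ (pickle (par u))).
      exists [:: pickle (par u)]; rewrite /= andbT; split=> //.
      by apply/orP; left; exact: map_f.
    by apply: IH (pus _ uu); have := rk _ uu; lia.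
  have vroot x : x \in vertices s -> conn x (pickle root).
    rewrite mem_cat => /orP[] /mapP[_ /mapP[u uu ->] -> /=]; apply: to_root.
      by rewrite inE uu orbT.
    exact: pus.
  by move=> x y /vroot xr /vroot/conn_sym; apply: conn_trans xr.
move=> c /andP[cc cu]; rewrite leqNgt; apply/negP => c3.
(* Rank read off a label; the default 0 is for numbers that encode no node. *)
pose rkn x := oapp rank 0 (unpickle x : option U).
have c0 : 0 < size c by lia.
have [x xc xmax] : exists2 x, x \in c & {in c, forall y, rkn y <= rkn x}.
  case: (@arg_maxnP _ (Ordinal c0) xpredT (fun i => rkn (nth 0 c i))) => // i _ im.
  exists (nth 0 c i); first exact: mem_nth.
  move=> y yc; have yi : index y c < size c by rewrite index_mem.
  by have := im (Ordinal yi) isT; rewrite /= nth_index.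
have up y : y \in c -> linked s x y ->
    y = oapp (fun u => pickle (par u)) 0 (unpickle x).
  move=> yc /linkP [u uu [[-> ->]|[yu xu]]]; first by rewrite pickleK.
  by have := xmax _ yc; rewrite yu xu /rkn !pickleK /=; have := rk _ uu; lia.
have [i [|y [|z q]] ci] := rot_to xc.
- by move: c3; rewrite -(size_rot i) ci.
- by move: c3; rewrite -(size_rot i) ci.
have memc w : w \in x :: y :: z :: q -> w \in c by rewrite -ci mem_rot.
move: cc cu; rewrite -(rot_cycle i) -(rot_uniq i) ci /=.
rewrite rcons_path => /and3P[xy _ /andP[_ zx]] /and3P[_ + _].
rewrite linked_sym in zx.
have [yc zc] : y \in c /\ last z q \in c.
  split; apply: memc; first by rewrite !inE eqxx orbT.
  by rewrite in_cons (in_cons y) mem_last !orbT.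
by rewrite (up _ yc xy) -(up _ zc zx) mem_last.
Qed.

(** * The bad input for Next-Fit *)

(* Hub [q] and spoke [p] carry the first, resp. second, half of the leaves in
   arrival order.  Hub [q] is the [q %/ n]-th hub of the chain number [q %% n];
   spoke [p] belongs to the chain whose number is [n - 1 - p %% n]. *)
Definition node : Type := (nat * nat)%type.
Definition root : node := (0, 0).
Definition hub q : node := (1, q).
Definition spoke p : node := (2, p).
Definition leaf t : node := (3, t).

(** [M] hubs in each of [n] chains, with n(n-1) leaves each. The M n(n-1) spokes with [n] leaves
    each have equally many in total, whence the factor 2 in [leaves]. *)
Definition hub_leaves n M := M * n * (n * (n - 1)).

Definition center n M t : node :=
  if t < hub_leaves n M then hub (t %/ (n * (n - 1)))
  else spoke ((t - hub_leaves n M) %/ n).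

(** The quotient is the position in the chain: the [n] hubs at one position have n(n-1) child spokes
    together. The residue is reversed so that the spoke carries the color block that the hub
    misses. *)
Definition hub_of n p := p %/ (n * (n - 1)) * n + (n - 1 - p %% n).

(* The last child of the previous hub in the chain. *)
Definition spoke_of n q :=
  ((q %/ n - 1) * (n - 1) + (n - 2)) * n + (n - 1 - q %% n).

Definition parent n M (u : node) : node :=
  match u.1 with
  | 0 => root
  | 1 => if u.2 < n then root else spoke (spoke_of n u.2)
  | 2 => hub (hub_of n u.2)
  | _ => center n M u.2
  end.

Definition leaves n M := [seq leaf t | t <- iota 0 (2 * hub_leaves n M)].
Definition links n M := [seq spoke p | p <- iota 0 (M * (n * (n - 1)))] ++
  [seq hub q | q <- iota n (M * n - n)].
(* These connect the [n] chains; their fate does not matter. *)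
Definition joins n := [seq hub q | q <- iota 0 n].
Definition nodes n M := (leaves n M ++ links n M) ++ joins n.

Definition bad_input n M := parent_tree (parent n M) (nodes n M).

(** * The bad input is a tree *)

Lemma mem_nodes n M (u : node) : 0 < M ->
  (u \in nodes n M) =
  match u.1 with
  | 0 => false | 1 => u.2 < M * n | 2 => u.2 < M * (n * (n - 1))
  | 3 => u.2 < 2 * hub_leaves n M | _ => false
  end.
Proof.
move=> M0; have mapE (c : nat) (l : seq nat) (v : node) :
    (v \in [seq ((c, i) : node) | i <- l]) = (v.1 == c) && (v.2 \in l).
  apply/mapP/andP => [[i il ->] //=|[/eqP <- il]].
  by exists v.2 => //; case: v il.
rewrite /nodes /leaves /links /joins !mem_cat !mapE !mem_iota.
case: u => [[|[|[|[|a]]]] b] //=; rewrite ?orbF //.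
have : n <= M * n by rewrite leq_pmull.
by lia.
Qed.

Lemma rem_lt n r : 0 < n -> n - 1 - r < n.
Proof. lia. Qed.

Lemma hub_of_mod n p : 0 < n -> hub_of n p %% n = n - 1 - p %% n.
Proof. by move=> n0; rewrite modnMDl modn_small ?rem_lt. Qed.

Lemma hub_of_div n p : 0 < n -> hub_of n p %/ n = p %/ (n * (n - 1)).
Proof. by move=> n0; rewrite divnMDl // [X in _ + X]divn_small ?addn0 ?rem_lt. Qed.

Lemma spoke_of_mod n q : 0 < n -> spoke_of n q %% n = n - 1 - q %% n.
Proof. by move=> n0; rewrite modnMDl modn_small ?rem_lt. Qed.

Lemma spoke_of_lt n q : 1 < n -> n <= q ->
  spoke_of n q < q %/ n * (n * (n - 1)).
Proof.
move=> n1 nq; have a1 : 0 < q %/ n by rewrite divn_gt0 //; lia.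
rewrite /spoke_of; move: (q %/ n) (q %% n) a1 => a r a1.
have -> : a * (n * (n - 1)) = ((a - 1) * (n - 1) + (n - 1)) * n.
  rewrite -mulSnr (_ : (a - 1).+1 = a); last by lia.
  by rewrite (mulnC n) mulnA.
rewrite (_ : (a - 1) * (n - 1) + (n - 1) = ((a - 1) * (n - 1) + (n - 2)).+1).
  by rewrite mulSnr ltn_add2l rem_lt //; lia.
by lia.
Qed.

Lemma hub_of_lt n M p : 0 < n -> p < M * (n * (n - 1)) -> hub_of n p < M * n.
Proof.
move=> n0 pM; have pa : p %/ (n * (n - 1)) < M.
  by rewrite ltn_divLR //; case: (n * (n - 1)) pM => //; rewrite muln0.
rewrite /hub_of; apply: (@leq_trans ((p %/ (n * (n - 1))).+1 * n)).
  by rewrite mulSnr ltn_add2l rem_lt.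
by rewrite leq_mul2r pa orbT.
Qed.

Lemma center_leaves n M t : 1 < n -> t < 2 * hub_leaves n M ->
  (exists2 q, q < M * n & center n M t = hub q) \/
  (exists2 p, p < M * (n * (n - 1)) & center n M t = spoke p).
Proof.
move=> n1; rewrite /center => tT; have d0 : 0 < n * (n - 1) by rewrite muln_gt0; lia.
case: ifP => [tl|/negbT]; [left|rewrite -leqNgt => tl; right].
  by exists (t %/ (n * (n - 1))) => //; rewrite ltn_divLR.
exists ((t - hub_leaves n M) %/ n) => //; rewrite ltn_divLR; last by lia.
have : hub_leaves n M = M * (n * (n - 1)) * n by rewrite /hub_leaves mulnAC.
by lia.
Qed.

Lemma bad_input_is_tree n M : 1 < n -> 0 < M -> is_tree (bad_input n M).
Proof.
move=> n1 M0; have n0 : 0 < n by lia.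
have d0 : 0 < n * (n - 1) by rewrite muln_gt0; lia.
(* Hubs and spokes alternate down a chain, with ranks 2a + 1 and 2a + 2 at position a; the leaves
   rank above them all. *)
pose rank (u : node) := match u.1 with
  | 0 => 0 | 1 => 2 * (u.2 %/ n) + 1 | 2 => 2 * (u.2 %/ (n * (n - 1))) + 2
  | _ => 2 * M + 3 end.
have hdiv q : q < M * n -> q %/ n < M by rewrite ltn_divLR.
have sdiv p : p < M * (n * (n - 1)) -> p %/ (n * (n - 1)) < M by rewrite ltn_divLR.
have sM q : n <= q -> spoke_of n q %/ (n * (n - 1)) < q %/ n.
  by move=> nq; rewrite ltn_divLR // spoke_of_lt.
apply: (@parent_tree_is_tree _ _ _ root rank).
- have [hI sI lI] : [/\ injective hub, injective spoke & injective leaf].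
    by split=> i j [].
  rewrite /nodes /leaves /links /joins !cat_uniq (map_inj_uniq lI).
  rewrite (map_inj_uniq sI) !(map_inj_uniq hI) !iota_uniq /=.
  rewrite !andbT -andbA; apply/and3P; split=> //.
  + by apply/hasPn => u; rewrite mem_cat => /orP[] /mapP[i _ ->];
      apply/mapP => -[j _].
  + by apply/hasPn => u /mapP[i _ ->]; apply/mapP => -[j _].
  + apply/hasPn => u /mapP[i im ->]; rewrite !mem_cat !negb_or.
    apply/and3P; split; apply/mapP => -[j jm] // [ij].
    by move: im jm; rewrite ij !mem_iota; lia.
- by rewrite mem_nodes.
- move=> [[|[|[|[|a]]]] b]; rewrite mem_nodes //= /parent /rank /= => bM.
  + case: (ltnP b n) => [_|/sM] /=; first by rewrite addn1.
    by move: (_ %/ _) (b %/ n) => a c; lia.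
  + by rewrite hub_of_div // ltn_add2l.
  + have [[q /hdiv + ->]|[p /sdiv + ->]] := center_leaves n1 bM => /=.
      by move: (q %/ _) => a; lia.
    by move: (p %/ _) => a; lia.
- move=> [[|[|[|[|a]]]] b]; rewrite mem_nodes //= /parent /= => bM.
  + case: (ltnP b n) => nb; first exact: mem_head.
    rewrite in_cons mem_nodes //=.
    apply: leq_trans (spoke_of_lt n1 nb) _.
    by rewrite leq_mul2r ltnW ?orbT // hdiv.
  + by rewrite in_cons mem_nodes //= hub_of_lt ?orbT.
  + by have [[q qM ->]|[p pM ->]] := center_leaves n1 bM;
      rewrite in_cons mem_nodes //= ?qM ?pM.
Qed.

(** * A coloring of the bad input that omits only the joins *)

(* [n ^ 2] is out of range and stands for an edge left uncolored. *)
Definition bad_color n M (u : node) : nat :=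
  match u.1 with
  | 0 => n ^ 2
  | 1 => if u.2 < n then n ^ 2 else n * (n - 1)
  | 2 => n * (n - 1) + 1 + (u.2 %/ n) %% (n - 1)
  | _ => if u.2 < hub_leaves n M then u.2 %% (n * (n - 1))
         else (u.2 - hub_leaves n M) %% n
  end.

Lemma leaf_color_lt n M t : 1 < n -> bad_color n M (leaf t) < n * (n - 1).
Proof.
move=> n1; rewrite /bad_color /=; case: ifP => _.
  by rewrite ltn_pmod // muln_gt0; lia.
apply: (@leq_trans n); first by rewrite ltn_pmod; lia.
by rewrite leq_pmulr //; lia.
Qed.

Lemma divmod_inj d i j : i %/ d = j %/ d -> i %% d = j %% d -> i = j.
Proof. by move=> e1 e2; rewrite (divn_eq i d) (divn_eq j d) e1 e2. Qed.

(** Colors are layered: leaf edges lie below n(n-1), the edge from a hub up to a spoke has exactly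
    n(n-1), and the n - 1 child spokes of a hub share the n - 1 colors above. In a parent tree,
    adjacent edges are siblings, treated here, or child and parent, treated in
    [bad_color_parent]. *)
Lemma bad_color_siblings n M u v : 1 < n -> 0 < M ->
    u \in nodes n M -> v \in nodes n M -> parent n M u = parent n M v ->
    bad_color n M u = bad_color n M v -> bad_color n M u < n ^ 2 ->
  u = v.
Proof.
move=> n1 M0; rewrite !mem_nodes //.
have n0 : 0 < n by lia.
have mod_lt i : i %% n < n by rewrite ltn_pmod.
have mod_inj i j : n - 1 - i %% n = n - 1 - j %% n -> i %% n = j %% n.
  by have := mod_lt i; have := mod_lt j; lia.
have leaf_lt t := leaf_color_lt M t n1.
have hubE i j : parent n M (hub i) = parent n M (hub j) ->
    n <= i -> n <= j -> i = j.
  rewrite /parent /= => + ni nj; rewrite !ltnNge ni nj /= => -[sij].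
  have rij : i %% n = j %% n.
    by apply: mod_inj; rewrite -!spoke_of_mod ?sij.
  apply: divmod_inj rij.
  have : 0 < i %/ n /\ 0 < j %/ n by rewrite !divn_gt0 // ni.
  move: (congr1 (divn^~ n) sij); rewrite !divnMDl //.
  rewrite ![(n - 1 - _) %/ n]divn_small ?rem_lt //.
  rewrite !addn0 => /addIn/eqP; rewrite eqn_pmul2r; last by rewrite subn_gt0.
  by move: (i %/ n) (j %/ n) => a b /eqP; lia.
have spokeE i j : parent n M (spoke i) = parent n M (spoke j) ->
    (i %/ n) %% (n - 1) = (j %/ n) %% (n - 1) -> i = j.
  rewrite /parent /= => -[hij] cij.
  apply: (@divmod_inj n); last by apply: mod_inj; rewrite -!hub_of_mod ?hij.
  by apply: divmod_inj cij; rewrite -!divnMA -!hub_of_div ?hij.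
have leafE i j : center n M i = center n M j ->
    bad_color n M (leaf i) = bad_color n M (leaf j) -> i = j.
  rewrite /center /bad_color /=; case: ltnP => iT; case: ltnP => jT // -[].
    exact: divmod_inj.
  by move=> e1 e2; have := divmod_inj e1 e2; lia.
have hub_bad i : bad_color n M (hub i) < n ^ 2 ->
    n <= i /\ bad_color n M (hub i) = n * (n - 1).
  by rewrite /bad_color /=; case: (ltnP i n) => //; rewrite ltnn.
case: u => [[|[|[|[|a]]]] i] //; case: v => [[|[|[|[|b]]]] j] //= _ _.
- move=> pE cE cn; have [ni _] := hub_bad i cn.
  by move: cn; rewrite cE => cn; have [nj _] := hub_bad j cn; rewrite (hubE i j).
- by rewrite /parent /=; case: ifP.
- move=> _ cE /hub_bad[_]; have := leaf_lt j; rewrite -cE => /[swap] ->.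
  by rewrite ltnn.
- by rewrite /parent /=; case: ifP.
- move=> pE cE _; rewrite (spokeE i j) //.
  by move: cE; rewrite /bad_color /=; lia.
- move=> _ cE _; have := leaf_lt j; rewrite -cE /bad_color /=; lia.
- move=> _ cE; rewrite cE => /hub_bad[_].
  have := leaf_lt i; rewrite cE => /[swap] ->.
  by rewrite ltnn.
- move=> _ cE _; have := leaf_lt i; rewrite cE /bad_color /=; lia.
- by move=> pE cE _; rewrite (leafE i j).
Qed.

Lemma bad_color_parent n M u : 1 < n -> 0 < M -> u \in nodes n M ->
    bad_color n M u < n ^ 2 ->
  bad_color n M u != bad_color n M (parent n M u).
Proof.
move=> n1 M0; rewrite mem_nodes //.
have leaf_lt t := leaf_color_lt M t n1.
have n2 : n * (n - 1) < n ^ 2 by rewrite -mulnn ltn_pmul2l; lia.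
case: u => [[|[|[|[|a]]]] i] //=.
- rewrite {2}/bad_color /parent /bad_color /=; case: ifP; first by rewrite ltnn.
  by move=> _ _ _ /=; apply/eqP; lia.
- rewrite /parent /bad_color /=; case: ifP => _ _ _; first by apply/eqP; lia.
  by apply/eqP; lia.
- move=> it _; have := leaf_lt i; rewrite /parent /=.
  have [[q _ ->]|[p _ ->]] := center_leaves n1 it; last first.
    by rewrite [X in _ != X]/bad_color /=; move: (bad_color _ _ _) => c; lia.
  by rewrite [X in _ != X]/bad_color /=; case: ifP => _;
    move: (bad_color _ _ _) => c; lia.
Qed.

(** [bad_color] colors every edge but the [n] joins, which the summand [n] makes up for. The left
    side counts all edges: 2M n^2 (n-1) at leaves, M n(n-1) above spokes and M n above hubs. *)
Lemma opt_bad_input n M k : 1 < n -> 0 < M -> k = n ^ 2 ->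
  M * (n ^ 2 * (2 * n - 1)) <= opt k (bad_input n M) + n.
Proof.
move=> n1 M0 kn.
pose t := [seq insub (bad_color n M u) : option 'I_k | u <- nodes n M].
have zipE : zip (bad_input n M) t =
    [seq ((pickle u, pickle (parent n M u)), insub (bad_color n M u))
    | u <- nodes n M].
  by rewrite /bad_input /parent_tree /t; elim: (nodes n M) => //= u l ->.
have unodes : uniq (nodes n M).
  have [[_ +] _ _] := bad_input_is_tree n1 M0.
  rewrite /bad_input /parent_tree pairwise_map uniq_pairwise.
  apply: sub_pairwise => u v; apply: contra => /eqP ->.
  by rewrite /same_edge eqxx.
have pkI : injective (@pickle node) := pcan_inj pickleK.
have pt : proper (zip (bad_input n M) t).
  rewrite zipE /proper pairwise_map.
  apply: (sub_in_pairwise (P := mem (nodes n M)) (r := fun u v => u != v)).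
  - move=> u v uN vN uv /=; apply/implyP.
    case: insubP => //= c; rewrite {1}kn => cu cE.
    have [cuv|/negP] := boolP (insub (bad_color n M v) == Some c); last first.
      by rewrite eq_sym => /negP.
    have vE : bad_color n M u = bad_color n M v.
      by move: cuv; case: insubP => //= d _ dE /eqP[dc]; rewrite -cE -dE dc.
    rewrite /adjacent /= !(inj_eq pkI) (negbTE uv) /= => /or3P[] /eqP e.
    + have := bad_color_parent n1 M0 vN; rewrite -e -vE eqxx => /(_ cu) //.
    + have := bad_color_parent n1 M0 uN; rewrite e -vE eqxx => /(_ cu) //.
    + by case/eqP: uv; apply: bad_color_siblings e vE cu.
  - exact/allP.
  - by rewrite -uniq_pairwise.
have sz : size t = size (bad_input n M) by rewrite !size_map.
apply: leq_trans (leq_add (opt_ge sz pt) (leqnn n)).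
have all_col u : u \in leaves n M ++ links n M -> bad_color n M u < k.
  have d_lt : n * (n - 1) < k by rewrite kn -mulnn ltn_pmul2l; lia.
  rewrite mem_cat => /orP[/mapP[i _ ->]|].
    exact: ltn_trans (leaf_color_lt M i n1) d_lt.
  rewrite mem_cat => /orP[] /mapP[i + ->]; rewrite mem_iota /bad_color /= => ii.
    have : (i %/ n) %% (n - 1) < n - 1 by rewrite ltn_pmod; lia.
    move: (_ %% _) => r rn; rewrite kn; nia.
  by case/andP: ii => ni _; rewrite (ltnNge i) ni.
have -> : num_colored (zip (bad_input n M) t)
    = count (fun u => bad_color n M u < k) (nodes n M).
  rewrite zipE /num_colored count_map; apply: eq_count => u /=.
  by case: insubP => [? -> //|/negbTE ->].
rewrite /nodes count_cat -addnA -(addnC n).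
have -> : count (fun u => bad_color n M u < k) (leaves n M ++ links n M)
    = size (leaves n M ++ links n M).
  by apply/eqP; rewrite -all_count; apply/allP.
rewrite /leaves /links !size_cat !size_map !size_iota /hub_leaves.
have nMn : n <= M * n by rewrite leq_pmull.
have -> : M * (n ^ 2 * (2 * n - 1)) =
    2 * (M * n * (n * (n - 1))) + (M * (n * (n - 1)) + M * n).
  case: (n) n1 => // m _; rewrite (_ : 2 * m.+1 - 1 = 2 * m + 1); last by lia.
  by rewrite [m.+1 - 1]subn1 -mulnn -addn1 addn1 /= -addn1; ring.
move: nMn; move: (M * n * (n * (n - 1))) (M * (n * (n - 1))) (M * n) => a b c; lia.
Qed.

(** * Next-Fit on the bad input *)

(** The leaves of a star arrive consecutively and number at most n(n-1); this is the spacing that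
    [next_fit_cyclic] asks for. *)
Lemma center_mod_inj n M i j : 1 < n -> i < j -> center n M i = center n M j ->
  j - i < n ^ 2.
Proof.
move=> n1 ij; have d_lt : n * (n - 1) <= n ^ 2 by rewrite -mulnn leq_pmul2l; lia.
have win d a b : 0 < d -> a %/ d = b %/ d -> b < a + d.
  move=> d0 e; rewrite (divn_eq a d) (divn_eq b d) e -addnA ltn_add2l.
  by have := ltn_pmod b d0; lia.
have d0 : 0 < n * (n - 1) by rewrite muln_gt0; lia.
have n_le : n <= n ^ 2 by rewrite -mulnn leq_pmulr; lia.
rewrite /center; case: (ltnP i _) => iT; case: (ltnP j _) => jT // -[].
  by move/(win _ _ _ d0); lia.
by move/(win _ _ _ (ltnW n1)); lia.
Qed.

(** Cut the colors into [n] blocks of [n] consecutive ones. With leaf [t] colored [t %% n ^ 2],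
    spoke [p] carries exactly block [p %% n], and hub [q] carries all blocks except
    [n - 1 - q %% n], which is the same block. *)
Lemma star_colors n M q p c : 1 < n -> q < M * n -> p < M * (n * (n - 1)) ->
    q %% n + p %% n = n - 1 -> c < n ^ 2 ->
  exists t, [/\ t < 2 * hub_leaves n M, t %% n ^ 2 = c &
    (center n M t == hub q) || (center n M t == spoke p)].
Proof.
move=> n1 qM pM qp ck; have n0 : 0 < n by lia.
have d0 : 0 < n * (n - 1) by rewrite muln_gt0; lia.
have xn : c %/ n < n by rewrite ltn_divLR // mulnn.
have yn : c %% n < n by rewrite ltn_pmod.
have cE := divn_eq c n.
have TE : hub_leaves n M = M * (n * (n - 1)) * n by rewrite /hub_leaves mulnAC.
have qr := divn_eq q n; have pr := divn_eq p n.
move: (c %/ n) (c %% n) cE xn yn => x y cE xn yn.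
(* [x] is the block of [c] and [y] its place there. [hub_leaves n M] is a multiple of [n ^ 2], so
   the star of spoke [p] starts with color [(p %% n) * n]. *)
case: (eqVneq x (p %% n)) => [xp|xp].
  exists (hub_leaves n M + (p * n + y)); split.
  - rewrite mul2n -addnn ltn_add2l TE.
    apply: (@leq_trans (p.+1 * n)); first by rewrite mulSnr ltn_add2l.
    by rewrite leq_mul2r pM orbT.
  - have -> : hub_leaves n M + (p * n + y) = (M * (n - 1) + p %/ n) * n ^ 2 + c.
      rewrite cE xp {1}pr /hub_leaves -mulnn.
      by move: (p %/ n) (p %% n) (n - 1) => a b m; ring.
    by rewrite modnMDl modn_small.
  - rewrite /center ltnNge leq_addr /= addKn divnMDl // divn_small // addn0.
    by rewrite eqxx ?orbT.
(* The star of hub [q] starts at q n(n-1), congruent to -(q mod n) n modulo n^2, so its leaf [j] has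
   color [c] when [j] is congruent to c + (q mod n) n. The representative below n^2 is even below
   n(n-1), as [x] is not the missing block. *)
have [j [jd jE]] : exists j, j < n * (n - 1) /\
    (j = c + (q %% n) * n \/ j + n ^ 2 = c + (q %% n) * n).
  move: (q %% n) (p %% n) qp xp {qr pr} => r s rs xs.
  case: (ltnP (x + r) n) => xr.
    exists (c + r * n); split; last by left.
    have : (x + r).+1 <= n - 1 by lia.
    rewrite -(leq_pmul2r n0) mulSnr mulnDl (mulnC n (n - 1)); lia.
  exists (c + r * n - n ^ 2); rewrite -mulnn; split.
    have : (x + r - n).+1 <= n - 1 by lia.
    rewrite -(leq_pmul2r n0) mulSnr mulnBl mulnDl (mulnC n (n - 1)); lia.
  right; rewrite subnK //; move: xr; rewrite -(leq_pmul2r n0) mulnDl; lia.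
exists (q * (n * (n - 1)) + j).
have tT : q * (n * (n - 1)) + j < hub_leaves n M.
  apply: (@leq_trans (q.+1 * (n * (n - 1)))); first by rewrite mulSnr ltn_add2l.
  by rewrite leq_mul2r qM orbT.
split; first by lia.
  have nE : n ^ 2 = n * (n - 1) + n.
    by rewrite -mulnn -{2}(subnK n0) mulnDr muln1.
  have e : q * n ^ 2 = q * (n * (n - 1)) + ((q %/ n) * n ^ 2 + (q %% n) * n).
    rewrite {1}nE mulnDr; congr addn; rewrite {1}qr -mulnn.
    by move: (q %/ n) (q %% n) => a b; ring.
  have -> : q * (n * (n - 1)) + j =
      (q * (n * (n - 1)) + j + (q %/ n) * n ^ 2) %[mod n ^ 2].
    by rewrite [in RHS]addnC modnMDl.
  case: jE => jE.
    have -> : q * (n * (n - 1)) + j + q %/ n * n ^ 2 = q * n ^ 2 + c by lia.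
    by rewrite modnMDl modn_small.
  rewrite -modnDr.
  have -> : q * (n * (n - 1)) + j + q %/ n * n ^ 2 + n ^ 2 = q * n ^ 2 + c by lia.
  by rewrite modnMDl modn_small.
by rewrite /center tT divnMDl // divn_small // addn0 eqxx.
Qed.

(** The leaf edges are colored cyclically, after which every link sees all colors; at most the leaf
    edges and the [n] joins are colored. *)
Lemma next_fit_bad_input n M k : 1 < n -> 0 < M -> k = n ^ 2 ->
  num_colored (run (@next_fit k) (bad_input n M)) <= 2 * hub_leaves n M + n.
Proof.
move=> n1 M0 kn; have n0 : 0 < n by lia.
have k0 : 0 < k by rewrite kn expn_gt0 n0.
have pkI : injective (@pickle node) := pcan_inj pickleK.
pose f t : edge := (pickle (leaf t), pickle (center n M t)).
have leavesE : parent_tree (parent n M) (leaves n M)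
    = [seq f t | t <- iota 0 (2 * hub_leaves n M)].
  by rewrite /parent_tree /leaves -map_comp.
have run_leaves : run (@next_fit k) (parent_tree (parent n M) (leaves n M)) =
    [seq (f t, insub (t %% k)) | t <- iota 0 (2 * hub_leaves n M)].
  rewrite leavesE next_fit_cyclic // => i j /andP[ij jT].
  have ne i' j' : j' < 2 * hub_leaves n M ->
      (leaf i' == center n M j') = false.
    by move=> jM; have [[? _ ->]|[? _ ->]] := center_leaves n1 jM.
  rewrite /adjacent /= !(inj_eq pkI) ne //.
  rewrite [center _ _ _ == leaf _]eq_sym ne; last first.
    exact: ltn_trans jT.
  rewrite !orFb => /orP[/eqP[ijE]|/eqP]; first by rewrite ijE ltnn in ij.
  by rewrite kn; exact: center_mod_inj.
have split_tree us vs : parent_tree (parent n M) (us ++ vs) =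
    parent_tree (parent n M) us ++ parent_tree (parent n M) vs.
  by rewrite /parent_tree map_cat.
rewrite /bad_input /nodes split_tree.
apply: leq_trans (num_colored_run_cat_le _ _ _) _.
rewrite [size _]size_map /joins size_map size_iota leq_add2r split_tree.
rewrite num_colored_run_rejected; last first.
  move=> pre e post eE; apply/eqP/next_fit_NoneP => c.
  have el : e \in parent_tree (parent n M) (links n M).
    by rewrite eE mem_cat mem_head orbT.
  (* Whichever end is the parent, a link joins a hub and a spoke with complementary residues, as
     [star_colors] requires. *)
  have [q [p [qM pM qp ee]]] : exists q p, [/\ q < M * n, p < M * (n * (n - 1)),
      q %% n + p %% n = n - 1 & e = (pickle (spoke p), pickle (hub q))
        \/ e = (pickle (hub q), pickle (spoke p))].
    have rem i : n - 1 - i %% n + i %% n = n - 1.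
      by have := ltn_pmod i n0; lia.
    case/mapP: el => u + ->; rewrite mem_cat.
    case/orP => /mapP[i + ->]; rewrite mem_iota => /andP[i1 i2].
      exists (hub_of n i), i; split; [exact: hub_of_lt|exact: i2| |by left].
      by rewrite hub_of_mod.
    have iM : i < M * n by have := leq_pmull n M0; lia.
    exists i, (spoke_of n i); split => //.
    - apply: leq_trans (spoke_of_lt n1 i1) _.
      by rewrite leq_mul2r ltnW ?orbT // ltn_divLR.
    - by rewrite spoke_of_mod // addnC rem.
    - by right; rewrite /parent /= ltnNge i1.
  have ck : c < n ^ 2 by rewrite -kn.
  have [t [tT tc tqp]] := star_colors n1 qM pM qp ck.
  apply/usedP; exists (f t).
    have [h ->] := run_cat (@next_fit k) (parent_tree (parent n M) (leaves n M)) pre.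
    rewrite mem_cat run_leaves; apply/orP; left; apply/mapP; exists t.
      by rewrite mem_iota.
    by rewrite -kn in tc; rewrite tc valK.
  by case: ee => ->; case/orP: tqp => /eqP ct; rewrite /adjacent /= ct eqxx ?orbT.
rewrite run_leaves /num_colored (leq_trans (count_size _ _)) //.
by rewrite size_map size_iota.
Qed.

(** * Competitive ratios *)

Local Open Scope ring_scope.

Lemma competitive_ratio_ge (R : realType) k (alg : seq edge -> \bar R) (C : R) :
    (forall s, is_tree s -> ((C * (opt k s)%:R)%:E <= alg s)%E) ->
  (C%:E <= competitive_ratio k alg)%E.
Proof.
move=> Calg; apply: ereal_sup_ubound; exists C => //; exists 0 => s ts.
by rewrite subr0; exact: Calg.
Qed.

(** The pointwise bound is integrated. The profit is measurable because there are countably many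
    histories, and its preimages are countable unions of events [run (A w) s = h]. *)
Lemma expected_profit_ge (R : realType) k (d : measure_display)
    (T : measurableType d) (P : probability T R) (A : T -> policy k) s (x : R) :
    randomized A -> is_tree s -> 0 <= x ->
    (forall w, x <= (num_colored (run (A w) s))%:R) ->
  (x%:E <= expected_profit P A s)%E.
Proof.
move=> rA ts x0 xle; rewrite /expected_profit unlock.
have -> : x%:E = (\int[P]_(w in setT) cst x%:E w)%E.
  by rewrite integral_cst //= probability_setT mule1.
apply: ge0_le_integral => //=; last by move=> w _; rewrite lee_fin.
apply/measurable_realfun.measurable_EFinP => _ B _; rewrite setTI.
have -> : ((fun w => (num_colored (run (A w) s))%:R : R) @^-1` B =
    \bigcup_(h : history k)
      [set w | run (A w) s = h /\ B (num_colored h)%:R])%classic.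
  apply/seteqP; split=> [w Bw|w [h _ [<- //]]].
  by exists (run (A w) s).
apply: countable_bigcupT_measurable; first exact: countableP.
move=> h; case: (pselect (B (num_colored h)%:R)) => Bh.
  rewrite (_ : [set w | _] = [set w | run (A w) s = h])%classic; first exact: rA.
  by apply/seteqP; split=> [w []|w].
rewrite (_ : [set w | _] = set0)%classic //.
by apply/seteqP; split=> [w []|w].
Qed.

Lemma sqrt_natr_sqr (R : realType) n : Num.sqrt (n ^ 2)%:R = n%:R :> R.
Proof. by rewrite natrX sqrtr_sqr ger0_norm. Qed.

Lemma fair_run_ratio (R : realType) n k (A : policy k) s :
    (2 <= n)%N -> k = (n ^ 2)%N -> online_algorithm A -> fair A -> is_tree s ->
  (2 * n%:R - 2) / (2 * n%:R - 1) * (opt k s)%:R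
    <= (num_colored (run A s))%:R :> R.
Proof.
move=> n2 kn onA fA ts; have := fair_run_bound n2 kn onA fA ts.
rewrite -(ler_nat R) !natrM !natrB ?natrM; [|lia|lia] => le.
have n2R : 2 <= n%:R :> R by rewrite (ler_nat R 2).
by rewrite mulrAC ler_pdivrMr; [rewrite [leRHS]mulrC|lra].
Qed.

(** If [C] exceeded the ratio, g = C(2n - 1) - (2n - 2) would be positive, while the bad inputs give
    M n^2 g <= b + C n + n for every positive [M], which fails for large [M]. *)
Lemma next_fit_competitive_le (R : realType) n k (C : R) :
    (2 <= n)%N -> k = (n ^ 2)%N ->
    competitive k (profit R (@next_fit k)) C ->
  C <= (2 * n%:R - 2) / (2 * n%:R - 1).
Proof.
move=> n2 kn [b Cb]; rewrite leNgt; apply/negP => Cv.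
have n2R : 2 <= n%:R :> R by rewrite (ler_nat R 2).
set N : R := n%:R in Cv n2R *.
have C0 : 0 < C by apply: le_lt_trans Cv; apply: divr_ge0; lra.
have gap : 0 < C * (2 * N - 1) - (2 * N - 2).
  by rewrite subr_gt0 -ltr_pdivrMr //; lra.
set g := C * _ - _ in gap.
have bound (M : nat) : (0 < M)%N -> M%:R * (N ^+ 2 * g) <= b + C * N + N.
  move=> M0; have := Cb _ (bad_input_is_tree n2 M0).
  rewrite lee_fin => h1.
  have := next_fit_bad_input n2 M0 kn; rewrite -(ler_nat R) => h2.
  have := opt_bad_input n2 M0 kn; rewrite -(ler_nat R) => h3.
  have {h1 h2} := le_trans h1 h2.
  move: h3; set O := (opt _ _)%:R.
  rewrite /hub_leaves !natrD !natrM !natrB ?natrM; [|lia|lia].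
  rewrite -/N => h3 h4.
  have := ler_wpM2l (ltW C0) h3; rewrite /g => h5.
  by move: h4 h5; rewrite !mulrDr; lra.
have g0 : 0 < N ^+ 2 * g by rewrite mulr_gt0 // exprn_gt0 //; lra.
have := archi_boundP (normr_ge0 ((b + C * N + N) / (N ^+ 2 * g))).
set m := Num.bound _ => lem.
have := bound m.+1 isT; rewrite -ler_pdivlMr // leNgt => /negP; apply.
apply: le_lt_trans (ler_norm _) _; apply: lt_trans lem _.
by rewrite ltr_nat.
Qed.

Theorem theorem7 (R : realType) (n k : nat) (hn : (2 <= n)%N)
    (hk : k = (n ^ 2)%N) :
  let v : R := (2 * Num.sqrt k%:R - 2) / (2 * Num.sqrt k%:R - 1) in
  [/\ online_algorithm (@next_fit k) /\ fair (@next_fit k),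
      competitive_ratio k (profit R (@next_fit k)) = v%:E,
      forall A : policy k, online_algorithm A -> fair A ->
        (v%:E <= competitive_ratio k (profit R A))%E
    & forall (d : measure_display) (T : measurableType d)
        (P : probability T R) (A : T -> policy k),
        randomized A ->
        (forall w, online_algorithm (A w)) -> (forall w, fair (A w)) ->
        (v%:E <= competitive_ratio k (expected_profit P A))%E].
Proof.
move=> v.
have vE : v = (2 * n%:R - 2) / (2 * n%:R - 1).
  by rewrite /v hk sqrt_natr_sqr.
have v0 : 0 <= v.
  have n2R : 2 <= n%:R :> R by rewrite (ler_nat R 2).
  by rewrite vE; apply: divr_ge0; lra.
have fair_ge (A : policy k) : online_algorithm A -> fair A ->
    (v%:E <= competitive_ratio k (profit R A))%E.
  move=> onA fA; apply: competitive_ratio_ge => s ts.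
  by rewrite lee_fin vE; exact: (fair_run_ratio R hn hk onA fA ts).
have [onNF fNF] := (@next_fit_online k, @next_fit_fair k).
split=> //.
  (* Next-Fit is itself fair, so only the upper bound remains. *)
  apply/eqP; rewrite eq_le fair_ge // andbT.
  apply: ge_ereal_sup => _ [C CC <-].
  by rewrite lee_fin vE; exact: next_fit_competitive_le CC.
move=> d T P A rA onA fA; apply: competitive_ratio_ge => s ts.
apply: expected_profit_ge => // [|w]; first by rewrite mulr_ge0.
by rewrite vE; exact: (fair_run_ratio R hn hk (onA w) (fA w) ts).
Qed.
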